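(* Let $N\ge1$ be an integer and $\chi$ a Dirichlet character of conductor $f$. For $m\ge 1$ put $\alpha_m=\frac{N!\,f^m}{(N+m)!}$, $\alpha_0=1$, and $\alpha_m=0$ for $m<0$; put \[ \widehat S_m=\frac{1}{f^N}\sum_{a=1}^f\chi(a)\left(\frac{N!}{(N+m)!}f^m-\frac{a^m}{m!}\right),\qquad \widehat S_m(x)=\frac{1}{f^N}\sum_{a=1}^f\chi(a)\left(\frac{N!}{(N+m)!}f^m-\frac{(x+a)^m}{m!}\right). \] For $n\ge1$ let $M_n$ be the $n\times n$ matrix whose entries are $(M_n)_{i,j}=\alpha_{i-j+1}$ for $1\le i\le n-1$, $1\le j\le n$, and $(M_n)_{n,j}=\widehat S_{n-j+1}$ for $1\le j\le n$; i.e. \[ M_n=\begin{pmatrix} \alpha_1&1&0&\cdots&0\\ \alpha_2&\alpha_1&1&\ddots&\vdots\\ \vdots&&\ddots&\ddots&0\\ \alpha_{n-1}&\cdots&\alpha_2&\alpha_1&1\\ \widehat S_n&\widehat S_{n-1}&\cdots&\widehat S_2&\widehat S_1 \end{pmatrix}, \] and let $M_n(x)$ be the same matrix with last row $\widehat S_n(x),\widehat S_{n-1}(x),\dots,\widehat S_1(x)$. Then for $n\ge1$, \[ B_{N,n,\chi}=(-1)^n n!\,\det M_n,\qquad B_{N,n,\chi}(x)=(-1)^n n!\,\det M_n(x). \]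
   Context: For an integer $N\ge 1$ and a Dirichlet character $\chi$ of conductor $f$, the generalized hypergeometric Bernoulli numbers $B_{N,n,\chi}$ and polynomials $B_{N,n,\chi}(x)$ are defined by $\sum_{a=1}^f \frac{\chi(a)\, t^N e^{at}/N!}{e^{ft}-\sum_{m=0}^{N-1}\frac{(ft)^m}{m!}}=\sum_{n=0}^\infty B_{N,n,\chi}\frac{t^n}{n!}$ and $\sum_{a=1}^f \frac{\chi(a)\, t^N e^{(x+a)t}/N!}{e^{ft}-\sum_{m=0}^{N-1}\frac{(ft)^m}{m!}}=\sum_{n=0}^\infty B_{N,n,\chi}(x)\frac{t^n}{n!}$ for $|t|<2\pi/f$. *)

(* Defs.v *)
From mathcomp Require Import all_boot all_order all_algebra.
From mathcomp Require Import complex.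
From mathcomp Require Import boolp classical_sets reals topology normedtype.
From mathcomp Require Import sequences trigo.

Set Implicit Arguments.
Unset Strict Implicit.
Unset Printing Implicit Defensive.

Import Order.TTheory GRing.Theory Num.Theory.
Import numFieldNormedType.Exports.

Local Open Scope classical_set_scope.
Local Open Scope complex_scope.
Local Open Scope ring_scope.

Definition dirichlet_character (R : realType) (q : nat) (chi : int -> R[i]) :=
  [/\ (0 < q)%N,
      forall a b : int, chi (a * b) = chi a * chi b,
      forall a : int, chi (a + q%:Z) = chi a
    & forall a : int, (chi a != 0) = coprimez a q].

(* chi mod q factors through (Z/q)^* -> (Z/d)^* *)
Definition induced_modulus (R : realType) (q : nat) (chi : int -> R[i])
    (d : nat) :=
  [/\ (0 < d)%N, (d %| q)%N
    & forall a b : int, coprimez a q -> coprimez b q ->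
        (a = b %[mod d])%Z -> chi a = chi b].

(* The case q = f is that of a primitive character modulo f. *)
Definition dirichlet_character_of_conductor (R : realType) (f : nat)
    (chi : int -> R[i]) :=
  exists q : nat, [/\ dirichlet_character q chi, induced_modulus q chi f
    & forall d : nat, induced_modulus q chi d -> (f <= d)%N].

Definition expC (R : realType) (z : R[i]) : R[i] :=
  limn (series (fun k : nat => z ^+ k / k`!%:R : R[i]^o)).

Definition exp_gen_series (R : realType) (B : nat -> R[i]) (t : R[i]) :
    nat -> R[i]^o :=
  series (fun k : nat => B k * (t ^+ k / k`!%:R)).

Definition bernoulli_denom (R : realType) (N f : nat) (t : R[i]) : R[i] :=
  expC (f%:R * t) - \sum_(0 <= m < N) (f%:R * t) ^+ m / m`!%:R.

(* The generating functions have a removable singularity at t = 0, where the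
   quotient reads 0 / 0; the point t = 0 is therefore left out. *)
Definition is_hypergeometric_bernoulli_numbers (R : realType) (N f : nat)
    (chi : int -> R[i]) (B : nat -> R[i]) :=
  forall t : R[i], t != 0 -> `|t| < (2 * pi / f%:R)%:C ->
    exp_gen_series B t @ \oo -->
      ((\sum_(1 <= a < f.+1)
          chi a%:Z * t ^+ N * expC (a%:R * t) / N`!%:R / bernoulli_denom N f t)
       : R[i]^o).

Definition is_hypergeometric_bernoulli_polynomials (R : realType) (N f : nat)
    (chi : int -> R[i]) (B : nat -> R[i] -> R[i]) :=
  forall x t : R[i], t != 0 -> `|t| < (2 * pi / f%:R)%:C ->
    exp_gen_series (B ^~ x) t @ \oo -->
      ((\sum_(1 <= a < f.+1)
          chi a%:Z * t ^+ N * expC ((x + a%:R) * t) / N`!%:R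
            / bernoulli_denom N f t)
       : R[i]^o).

Definition alpha (R : realType) (N f : nat) (m : int) : R[i] :=
  match m with
  | Posz 0 => 1
  | Posz k => N`!%:R * f%:R ^+ k / (N + k)`!%:R
  | Negz _ => 0
  end.

Definition Shat (R : realType) (N f : nat) (chi : int -> R[i]) (m : nat) :
    R[i] :=
  (f%:R ^+ N)^-1 * \sum_(1 <= a < f.+1)
    chi a%:Z * (N`!%:R / (N + m)`!%:R * f%:R ^+ m - a%:R ^+ m / m`!%:R).

Definition Shat_poly (R : realType) (N f : nat) (chi : int -> R[i]) (m : nat)
    (x : R[i]) : R[i] :=
  (f%:R ^+ N)^-1 * \sum_(1 <= a < f.+1)
    chi a%:Z * (N`!%:R / (N + m)`!%:R * f%:R ^+ m
                - (x + a%:R) ^+ m / m`!%:R).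

(* Rows and columns are numbered from 0: i - j + 1 is unchanged by the shift,
   while the index n - j + 1 of the last row becomes n - j. *)
Definition bernoulli_mx (R : realType) (N f n : nat) (s : nat -> R[i]) :
    'M[R[i]]_n :=
  \matrix_(i < n, j < n)
    if (i.+1 < n)%N then alpha R N f (i%:Z - j%:Z + 1) else s (n - j)%N.

(* Main.v *)
(* Write b_n = B_n / n!, A(t) = sum_m alpha_m t^m and
   E(t) = f^-N sum_a chi(a) e^(a t).  The denominator of the generating function
   is (f t)^N / N! * A(t), so the definition of the B_n reads A(t) b(t) = E(t) for
   small t <> 0.  Comparing Taylor expansions at 0 gives
   sum_k alpha_k b_(n-k) = E_n for all n; since S_m = alpha_m E_0 - E_m and
   b_0 = E_0, this is the unitriangular system
   sum_(k < n) alpha_k b_(n-k) = - S_n (n >= 1), and the signed determinants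
   (-1)^n det M_n satisfy the same recurrence.

   No Cauchy product of series is needed: every function involved has Taylor
   polynomials of all orders at 0, these multiply like polynomials, and their
   coefficients are determined by the function near 0. *)

Require Import Defs.
From mathcomp Require Import all_boot all_order all_algebra.
From mathcomp Require Import complex.
From mathcomp Require Import boolp classical_sets reals topology normedtype.
From mathcomp Require Import sequences trigo.
From mathcomp Require Import ring.

Import Order.TTheory GRing.Theory Num.Theory.
Import numFieldNormedType.Exports.
Local Open Scope classical_set_scope.
Local Open Scope complex_scope.
Local Open Scope ring_scope.

(* The neighbourhood of 0 is punctured because at t = 0 the generating functions
   take the junk value 0 / 0 = 0. *)
Definition jet {K : numFieldType} (n : nat) (F : K -> K) (p : {poly K}) :=
  exists2 C : K, 0 <= C & \forall t \near (0 : K)^', `|F t - p.[t]| <= C * `|t| ^+ n.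

(** * Taylor polynomials at 0: products, uniqueness, power series *)

Section Jet.
Context {K : numFieldType}.
Implicit Types (F G : K -> K) (p q : {poly K}) (n : nat).

Lemma near_dnbhs0_norm_lt (r : K) : 0 < r -> \forall t \near (0 : K)^', `|t| < r.
Proof.
move=> r0; rewrite near_withinE; near=> t => _.
by rewrite -[t]subr0 distrC; near: t; exact: (@nbhsx_ballx _ _ 0 r).
Unshelve. all: by end_near. Qed.

Lemma jet_poly n p : jet n (fun t => p.[t]) p.
Proof.
exists 0 => //; near=> t; by rewrite subrr normr0 mul0r.
Unshelve. all: by end_near. Qed.

Lemma jet_near n F G p : (\forall t \near (0 : K)^', F t = G t) -> jet n F p -> jet n G p.
Proof.
move=> FG [C C0 HC]; exists C => //; near=> t.
by rewrite -(near FG t) //; near: t.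
Unshelve. all: by end_near. Qed.

Lemma jetB n F G p q : jet n F p -> jet n G q -> jet n (fun t => F t - G t) (p - q).
Proof.
move=> [C C0 HC] [D D0 HD]; exists (C + D); first exact: addr_ge0.
near=> t.
have -> : F t - G t - (p - q).[t] = (F t - p.[t]) - (G t - q.[t]).
  by rewrite hornerD hornerN; ring.
by rewrite mulrDl (le_trans (ler_normB _ _)) // lerD //; near: t.
Unshelve. all: by end_near. Qed.

(** F G - p q = (F - p) G + p (G - q), where [G] and [p] are bounded near 0. The product [p * q]
    need not be truncated, since terms of degree at least [n] are absorbed in the error. *)
Lemma jetM n F G p q : jet n F p -> jet n G q -> jet n (fun t => F t * G t) (p * q).
Proof.
move=> [C C0 HC] [D D0 HD].
have [P hP] := poly_disk_bound p 1; have [Q hQ] := poly_disk_bound q 1.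
have P0 : 0 <= P by apply: le_trans (hP 0 _); rewrite ?normr_ge0 ?normr0.
have Q0 : 0 <= Q by apply: le_trans (hQ 0 _); rewrite ?normr_ge0 ?normr0.
exists (C * (Q + D) + P * D); first by rewrite !(addr_ge0, mulr_ge0).
near=> t.
have t1 : `|t| <= 1 by apply: ltW; near: t; exact: near_dnbhs0_norm_lt.
have Ft : `|F t - p.[t]| <= C * `|t| ^+ n by near: t.
have Gt : `|G t - q.[t]| <= D * `|t| ^+ n by near: t.
have tn1 : `|t| ^+ n <= 1 by rewrite exprn_ile1.
have GQD : `|G t| <= Q + D.
  rewrite -[G t](subrK q.[t]) addrC (le_trans (ler_normD _ _)) // lerD ?hQ //.
  by rewrite (le_trans Gt) // ler_piMr.
have -> : F t * G t - (p * q).[t] = (F t - p.[t]) * G t + p.[t] * (G t - q.[t]).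
  by rewrite hornerM; ring.
rewrite (le_trans (ler_normD _ _)) // !normrM mulrDl lerD //.
  by rewrite mulrAC ler_pM.
by rewrite -mulrA ler_pM // hP.
Unshelve. all: by end_near. Qed.

Lemma jet_sum n (I : Type) (s : seq I) (F : I -> K -> K) (p : I -> {poly K}) :
  (forall i, jet n (F i) (p i)) ->
  jet n (fun t => \sum_(i <- s) F i t) (\sum_(i <- s) p i).
Proof.
move=> Fp; elim: s => [|i s [C C0 HC]].
  exists 0 => //; near=> t; by rewrite !big_nil horner0 subrr normr0 mul0r.
have [D D0 HD] := Fp i; exists (D + C); first exact: addr_ge0.
near=> t; rewrite !big_cons hornerD opprD addrACA mulrDl.
by rewrite (le_trans (ler_normD _ _)) // lerD //; near: t.
Unshelve. all: by end_near. Qed.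

(** Letting t tend to 0 in the bound kills the constant coefficient; dividing by t then gives the
    same bound, one order lower, for [drop_poly 1 p]. *)
Lemma jet0_coef n p k : jet n (fun=> 0) p -> (k < n)%N -> p`_k = 0.
Proof.
elim: n k p => // n IHn k p [C C0 HC].
have [P hP] := poly_disk_bound (drop_poly 1 p) 1.
have P0 : 0 <= P by apply: le_trans (hP 0 _); rewrite ?normr_ge0 ?normr0.
have pE t : p.[t] = p`_0 + (drop_poly 1 p).[t] * t.
  rewrite -{1}(poly_take_drop 1 p) hornerD hornerM hornerXn expr1; congr (_ + _).
  by rewrite /take_poly poly_def big_ord1 expr0 alg_polyC hornerC.
have p0 : p`_0 = 0.
  apply/eqP; rewrite -normr_le0; apply/ler_addgt0Pr => e e0; rewrite add0r.
  near (0 : K)^' => t.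
  have t1 : `|t| <= 1 by apply: ltW; near: t; exact: near_dnbhs0_norm_lt.
  (* [C] accounts for the error term and [P] for the rest of the polynomial; the summand 1 makes the
     sum a positive divisor. *)
  have CP : 0 < C + P + 1 by rewrite ltr_wpDl ?addr_ge0.
  have te : (C + P + 1) * `|t| <= e.
    rewrite mulrC -ler_pdivlMr //; apply: ltW; near: t.
    by apply: near_dnbhs0_norm_lt; rewrite divr_gt0 // ltr_wpDl ?addr_ge0.
  have : `|0 - p.[t]| <= C * `|t| ^+ n.+1 by near: t.
  rewrite sub0r normrN => pt; rewrite (le_trans _ te) //.
  have -> : p`_0 = p.[t] - (drop_poly 1 p).[t] * t by rewrite pE addrK.
  rewrite (le_trans (ler_normB _ _)) // -addrA mulrDl lerD //.
    rewrite (le_trans pt) // ler_wpM2l // exprS ler_piMr // exprn_ile1 //.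
  by rewrite normrM ler_wpM2r // (le_trans (hP _ t1)) // lerDl.
case: k => [//|k]; rewrite ltnS => kn.
have -> : p`_k.+1 = (drop_poly 1 p)`_k by rewrite coef_drop_poly addn1.
apply: IHn kn; exists C => //; near=> t.
have t0 : 0 < `|t| by rewrite normr_gt0; near: t; exact: nbhs_dnbhs_neq.
have : `|0 - p.[t]| <= C * `|t| ^+ n.+1 by near: t.
by rewrite pE p0 !add0r !normrN normrM exprSr mulrA ler_pM2r.
Unshelve. all: by end_near. Qed.

Lemma jet_unique n F G p q k : (\forall t \near (0 : K)^', F t = G t) ->
  jet n F p -> jet n G q -> (k < n)%N -> p`_k = q`_k.
Proof.
move=> FG Fp Gq kn; apply/eqP; rewrite -subr_eq0 -coefB; apply/eqP.
apply: jet0_coef kn; apply: jet_near (jetB _ _ _ _ _ Fp Gq).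
by near=> t; apply/eqP; rewrite subr_eq0; apply/eqP; near: t.
Unshelve. all: by end_near. Qed.

(** Convergence at [s = r / 2] bounds the terms b_k s^k. For |t| <= s / 2 the tail from [n] on is
    then dominated by a geometric series of ratio at most 1/2, whence the factor 2 in the
    constant. *)
Lemma jet_power_series n (b : nat -> K) F (r : K) : 0 < r ->
  (forall t, t != 0 -> `|t| < r ->
     (series (fun k => b k * t ^+ k) : nat -> K^o) @ \oo --> (F t : K^o)) ->
  jet n F (\poly_(k < n) b k).
Proof.
move=> r0 bF; pose s := r / 2.
have s0 : 0 < s by rewrite divr_gt0.
have sr : s < r by rewrite ltr_pdivrMr // mulr_natr mulr2n ltrDl.
have ns : `|s| = s by rewrite gtr0_norm.
clearbody s.
have [M [Mre HM]] : bounded_fun (fun k => b k * s ^+ k : K^o).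
  apply/cvg_seq_bounded/cvgP/cvg_series_cvg_0/cvgP/bF; rewrite ?gt_eqF ?ns //.
have {HM} Hb k : `|b k| * s ^+ k <= `|M| + 1.
  rewrite -{1}ns -normrX -normrM; apply: (HM (`|M| + 1)) => //.
  by rewrite (le_lt_trans (real_ler_norm Mre)) // ltrDl.
pose M' := `|M| + 1.
have M'0 : 0 <= M' by rewrite addr_ge0.
have half k : \sum_(i < k) (2^-1 : K) ^+ i <= 2.
  suff -> : \sum_(i < k) (2^-1 : K) ^+ i = 2 - 2 * 2^-1 ^+ k.
    by rewrite gerBl mulr_ge0 // exprn_ge0 // invr_ge0.
  elim: k => [|k IHk]; first by rewrite big_ord0 expr0 mulr1 subrr.
  by rewrite big_ord_recr /= IHk exprS; field.
exists (M' * 2 / s ^+ n); first by rewrite divr_ge0 ?mulr_ge0 ?exprn_ge0 // ltW.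
near=> t.
have t0 : t != 0 by near: t; exact: nbhs_dnbhs_neq.
have ts : `|t| <= s / 2.
  by apply: ltW; near: t; apply: near_dnbhs0_norm_lt; rewrite divr_gt0.
have tr : `|t| < r.
  by rewrite (le_lt_trans ts) // (lt_trans _ sr) // ltr_pdivrMr // mulr_natr mulr2n ltrDl.
have tsq : `|t| / s <= 2^-1 by rewrite ler_pdivrMr // mulrC.
(* This bound is uniform in [m], so it passes to the limit of the partial sums. *)
have tail m : `|series (fun k => b k * t ^+ k) (n + m)%N - (\poly_(k < n) b k).[t]|
    <= M' * 2 / s ^+ n * `|t| ^+ n.
  rewrite horner_poly -(big_mkord xpredT (fun k => b k * t ^+ k)).
  rewrite -/(series (fun k => b k * t ^+ k) n) sub_series_geq ?leq_addr //.
  have -> : \sum_(n <= k < n + m) b k * t ^+ k = \sum_(k < m) b (k + n)%N * t ^+ (k + n).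
    by rewrite -{1}[n]add0n big_addn addKn big_mkord.
  rewrite (le_trans (ler_norm_sum _ _ _)) //.
  have -> : M' * 2 / s ^+ n * `|t| ^+ n = M' * (`|t| / s) ^+ n * 2.
    by rewrite expr_div_n; ring.
  have q0 : 0 <= `|t| / s by rewrite divr_ge0 // ltW.
  have Mq0 : 0 <= M' * (`|t| / s) ^+ n by rewrite mulr_ge0 // exprn_ge0.
  apply: le_trans (ler_wpM2l Mq0 (half m)).
  rewrite mulr_sumr ler_sum // => i _.
  have -> : `|b (i + n)%N * t ^+ (i + n)| =
      `|b (i + n)%N| * s ^+ (i + n) * ((`|t| / s) ^+ n * (`|t| / s) ^+ i).
    rewrite normrM normrX -[(`|t| / s) ^+ n * _]exprD [(n + i)%N]addnC -mulrA -exprMn.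
    by rewrite mulrCA divff ?mulr1 // gt_eqF.
  rewrite -[leRHS]mulrA ler_pM ?mulr_ge0 ?exprn_ge0 // ?ler_wpM2l ?exprn_ge0 //.
    by rewrite ltW.
  by rewrite lerXn2r // nnegrE // invr_ge0.
apply/ler_addgt0Pr => e e0.
have /cvgrPdist_lt /(_ e e0) [m0 _ Hm] := bF t t0 tr.
have := Hm (n + m0)%N (leq_addl _ _) => /= /ltW He.
rewrite -(subrK (series (fun k => b k * t ^+ k) (n + m0)%N) (F t)) -addrA addrC.
by rewrite (le_trans (ler_normD _ _)) // lerD.
Unshelve. all: by end_near. Qed.
(** At a zero of [F] the bound gives |c| <= C |t|, which fails for small t. *)
Lemma jet_neq0 n F (c : K) : c != 0 -> jet n.+1 F (c *: 'X^n) ->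
  \forall t \near (0 : K)^', F t != 0.
Proof.
move=> c0 [C C0 HC]; near=> t; apply/eqP => Ft0.
have t0 : 0 < `|t| by rewrite normr_gt0; near: t; exact: nbhs_dnbhs_neq.
have : `|F t - (c *: 'X^n).[t]| <= C * `|t| ^+ n.+1 by near: t.
rewrite Ft0 sub0r normrN hornerZ hornerXn normrM normrX exprS mulrA.
rewrite ler_pM2r ?exprn_gt0 // lt_geF //.
have CC1 : C * `|t| <= (C + 1) * `|t| by rewrite ler_wpM2r // lerDl.
rewrite (le_lt_trans CC1) // mulrC -ltr_pdivlMr ?ltr_wpDl //; near: t.
by apply: near_dnbhs0_norm_lt; rewrite divr_gt0 ?normr_gt0 // ltr_wpDl.
Unshelve. all: by end_near. Qed.

End Jet.

(** * Convergence and Taylor polynomials of the complex exponential *)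

Lemma cvg_complex (R : realType) (u : nat -> R[i]) (x y : R) :
  (fun n => complex.Re (u n)) @ \oo --> x -> (fun n => complex.Im (u n)) @ \oo --> y ->
  (u : nat -> R[i]^o) @ \oo --> (x +i* y : R[i]^o).
Proof.
move=> ux uy; apply/cvgrPdist_lt => e; rewrite ltcE /= => /andP[/eqP Ime e0].
(* A positive element of [R[i]] is real, so [e] splits into two real halves, one for each of the
   real and imaginary parts. *)
have eE : e = (complex.Re e / 2)%:C + (complex.Re e / 2)%:C.
  by rewrite -rmorphD /= -splitr; case: e Ime {e0} => a b /= ->.
have e20 : 0 < complex.Re e / 2 by rewrite divr_gt0.
move/cvgrPdist_lt: ux => /(_ _ e20) ux; move/cvgrPdist_lt: uy => /(_ _ e20) uy.
near=> n.
have xn : `|x - complex.Re (u n)| < complex.Re e / 2 by near: n.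
have yn : `|y - complex.Im (u n)| < complex.Re e / 2 by near: n.
rewrite eE.
have -> : (x +i* y) - u n = (x - complex.Re (u n))%:C + 'i%C * (y - complex.Im (u n))%:C.
  by case: (u n) => a b; apply/eqP; rewrite eq_complex /=; apply/andP; split; apply/eqP; ring.
rewrite (le_lt_trans (ler_normD _ _)) // ltrD //.
  by rewrite normc_def /= expr0n addr0 sqrtr_sqr ltcR.
rewrite normrM normc_def /= expr0n expr1n add0r sqrtr1 mul1r.
by rewrite normc_def /= expr0n addr0 sqrtr_sqr ltcR.
Unshelve. all: by end_near. Qed.

(** The modulus is taken as the real-valued [Normc.normc], so that the real and imaginary parts can
    be compared with it among real series. *)
Lemma cvg_complex_series (R : realType) (u : nat -> R[i]) :
  cvgn (series (fun k => Normc.normc (u k))) -> cvgn (series (u : nat -> R[i]^o)).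
Proof.
move=> cu.
have Re_sum n : complex.Re (series u n) = series (fun k => complex.Re (u k)) n.
  by rewrite /series /= raddf_sum.
have Im_sum n : complex.Im (series u n) = series (fun k => complex.Im (u k)) n.
  by rewrite /series /= raddf_sum.
have abs_cvg (v : nat -> R) : (forall k, `|v k| <= Normc.normc (u k)) -> cvgn (series v).
  move=> vu; apply: normed_cvg; apply: series_le_cvg cu => [k|k|k] //=;
    exact: le_trans (normr_ge0 _) (vu k).
have /cvg_ex[x Hx] : cvgn (series (fun k => complex.Re (u k))).
  by apply: abs_cvg => k; rewrite -lecR; exact: normc_ge_Re.
have /cvg_ex[y Hy] : cvgn (series (fun k => complex.Im (u k))).
  apply: abs_cvg => k; rewrite -sqrtr_sqr /Normc.normc; case: (u k) => a b /=.
  by rewrite ler_wsqrtr // lerDr sqr_ge0.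
apply/cvg_ex; exists (x +i* y); apply: cvg_complex.
  by under eq_fun do rewrite Re_sum.
by under eq_fun do rewrite Im_sum.
Qed.

(** [expC] is a [limn], meaningful only once convergence is known; the moduli of its terms form the
    real exponential series at |z|. *)
Lemma cvg_expC (R : realType) (z : R[i]) :
  (series (fun k => z ^+ k / k`!%:R : R[i]^o)) @ \oo --> (expC z : R[i]^o).
Proof.
apply: cvg_complex_series; rewrite /=.
have -> : (fun k => Normc.normc (z ^+ k / k`!%:R)) = exp_coeff (Normc.normc z).
  apply/funext => k; apply: complexI.
  rewrite /exp_coeff /= rmorphM rmorphXn fmorphV rmorph_nat.
  by rewrite -[LHS]/`|z ^+ k / k`!%:R| normrM normrX normfV normr_nat.
exact: is_cvg_series_exp_coeff.
Qed.

Lemma jet_expC (R : realType) n (w : R[i]) :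
  jet n (fun t => expC (w * t)) (\poly_(k < n) (w ^+ k / k`!%:R)).
Proof.
apply: (jet_power_series _ _ _ 1) => // t _ _.
have -> : (fun k => w ^+ k / k`!%:R * t ^+ k) = (fun k => (w * t) ^+ k / k`!%:R).
  by apply/funext => k; rewrite exprMn mulrAC.
exact: cvg_expC.
Qed.

(** * The recurrence for the determinants and its solution *)

Lemma alphaE (R : realType) N f k :
  alpha R N f (Posz k) = N`!%:R * f%:R ^+ k / (N + k)`!%:R.
Proof.
by case: k => //=; rewrite addn0 expr0 mulr1 divff // pnatr_eq0 -lt0n fact_gt0.
Qed.

(* With an arbitrary first column, Laplace expansion along the first row (whose
   entries beyond the second vanish) stays within the same family of matrices. *)
Definition first_col_mx {A : Type} {n} (c : nat -> A) (M : 'M[A]_n) : 'M[A]_n :=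
  \matrix_(i, j) if j == 0%N :> nat then c i else M i j.

(** The two nonzero entries of the first row are [c 0] and alpha_0 = 1. Deleting column 0 leaves a
    smaller [bernoulli_mx], as the indices depend only on differences; deleting column 1 keeps the
    first column, shifted by one. *)
Lemma det_first_col_bernoulli_mx (R : realType) (N f n : nat) (s c : nat -> R[i]) :
  \det (first_col_mx c (bernoulli_mx N f n.+2 s)) =
  c 0%N * \det (bernoulli_mx N f n.+1 s)
  - \det (first_col_mx (c \o S) (bernoulli_mx N f n.+1 s)).
Proof.
rewrite (expand_det_row _ ord0) !big_ord_recl big1 ?addr0 => [|j _]; last first.
  by rewrite !mxE /= mul0r.
rewrite !mxE /= /cofactor /= !addn0 expr0 expr1 !mul1r mulN1r.
congr (_ * _ - _); congr determinant; apply/matrixP => i j; rewrite !mxE /=.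
  by rewrite !ltnS subSS; congr (if _ then alpha _ _ _ _ else _); rewrite !intS; ring.
by case: j => [[|j] hj].
Qed.

Lemma det_first_col_bernoulli_mx_sum (R : realType) (N f n : nat) (s c : nat -> R[i]) :
  \det (first_col_mx c (bernoulli_mx N f n.+1 s)) =
  \sum_(k < n) (-1) ^+ k * c k * \det (bernoulli_mx N f (n - k) s) + (-1) ^+ n * c n.
Proof.
elim: n c => [|n IHn] c; first by rewrite det_mx11 !mxE /= big_ord0 add0r expr0 mul1r.
rewrite det_first_col_bernoulli_mx IHn big_ord_recl /= expr0 mul1r opprD -addrA.
rewrite -sumrN exprS mulN1r mulNr; congr (_ + (_ + _)).
by apply: eq_bigr => k _; rewrite /= exprS mulN1r !mulNr.
Qed.

(** Here [c] is the actual first column: alpha_(i+1) above the last entry [s n.+1]. *)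
Lemma det_bernoulli_mx_rec (R : realType) (N f n : nat) (s : nat -> R[i]) :
  \det (bernoulli_mx N f n.+1 s) =
  \sum_(k < n) (-1) ^+ k * alpha R N f k.+1%:Z * \det (bernoulli_mx N f (n - k) s)
  + (-1) ^+ n * s n.+1.
Proof.
pose c i := if (i < n)%N then alpha R N f i.+1%:Z else s n.+1.
have -> : bernoulli_mx N f n.+1 s = first_col_mx c (bernoulli_mx N f n.+1 s).
  apply/matrixP => i j; rewrite !mxE /c; case: eqP => //= ->.
  by rewrite ltnS subr0 subn0 addrC -intS.
rewrite det_first_col_bernoulli_mx_sum /c ltnn; congr (_ + _).
by apply: eq_bigr => k _; rewrite ltn_ord.
Qed.

(** Indices are shifted: [b n] stands for b_(n+1). The term k = 0 isolates [b n], and strong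
    induction turns the others into the terms of the determinant recurrence, up to sign. *)
Lemma bernoulli_mx_solve (R : realType) (N f : nat) (s b : nat -> R[i]) :
  (forall n, \sum_(k < n.+1) alpha R N f (Posz k) * b (n - k)%N = - s n.+1) ->
  forall n, b n = (-1) ^+ n.+1 * \det (bernoulli_mx N f n.+1 s).
Proof.
move=> hb n; elim/ltn_ind: n => n IHn.
have {hb} := hb n; rewrite big_ord_recl /= mul1r subn0 => /(canRL (addrK _)) ->.
rewrite det_bernoulli_mx_rec mulrDr mulr_sumr [RHS]addrC -sumrN; congr (_ + _).
  by rewrite mulrA -exprD addSn addnn -mul2n exprS exprM sqrrN !expr1n mulr1 mulN1r.
apply: eq_bigr => k _; have kn := ltn_ord k.
have sgn : (-1) ^+ n.+1 * (-1) ^+ k = - (-1) ^+ (n - k) :> R[i].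
  rewrite -{1}(subnK (ltnW kn)) exprS exprD mulN1r mulNr -mulrA -exprD addnn -mul2n.
  by rewrite exprM sqrrN !expr1n mulr1.
rewrite IHn ?ltn_subrL ?(leq_ltn_trans _ kn) // subnSK // !mulrA sgn !mulNr.
by congr (- (_ * _)); rewrite mulrC !mulrA.
Qed.

(** * Comparison of coefficients in the generating function *)

Section GeneratingFunction.
(* [w a] is [a] for the numbers and [x + a] for the polynomials. *)
Context {R : realType} (N f : nat) (chi : int -> R[i]) (w b : nat -> R[i]).
Context (f_gt0 : (0 < f)%N).
Context (b_gen : forall t : R[i], t != 0 -> `|t| < (2 * pi / f%:R)%:C ->
  exp_gen_series b t @ \oo -->
    ((\sum_(1 <= a < f.+1)
        chi a%:Z * t ^+ N * expC (w a * t) / N`!%:R / bernoulli_denom N f t)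
     : R[i]^o)).

(** The coefficient E_n of t^n in E(t) = f^-N sum_a chi(a) e^(w_a t). *)
Let moment n : R[i] :=
  (f%:R ^+ N)^-1 * \sum_(1 <= a < f.+1) chi a%:Z * (w a ^+ n / n`!%:R).

Let fact_neq0 k : k`!%:R != 0 :> R[i].
Proof. by rewrite pnatr_eq0 -lt0n fact_gt0. Qed.

Let fX_neq0 k : f%:R ^+ k != 0 :> R[i].
Proof. by rewrite expf_neq0 // pnatr_eq0 -lt0n. Qed.

Lemma jet_bernoulli_denom n : jet n (bernoulli_denom N f)
  (\poly_(k < n) (f%:R ^+ k / k`!%:R : R[i]) - \poly_(k < N) (f%:R ^+ k / k`!%:R)).
Proof.
apply: jet_near (jetB _ _ _ _ _ (jet_expC _ n f%:R) (jet_poly n _)).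
apply: nearW => t; rewrite /bernoulli_denom horner_poly big_mkord; congr (_ - _).
by apply: eq_bigr => k _; rewrite exprMn mulrAC.
Qed.

(** To order N + 1 the denominator is the single monomial (f^N / N!) t^N. This justifies clearing it
    from the generating function near 0. *)
Lemma bernoulli_denom_neq0 : \forall t \near (0 : R[i]^o)^', bernoulli_denom N f t != 0.
Proof.
apply: (jet_neq0 N _ (f%:R ^+ N / N`!%:R)); first by rewrite mulf_neq0 ?invr_eq0.
have := jet_bernoulli_denom N.+1.
by rewrite !poly_def big_ord_recr /= addrAC subrr add0r.
Qed.

Lemma bernoulli_convolution n :
  \sum_(k < n.+1) alpha R N f (Posz k) * (b (n - k) / (n - k)`!%:R) = moment n.
Proof.
under eq_bigr do rewrite alphaE.
(* The coefficients of t^(N + n) are compared, so jets of order N + n + 1 suffice. *)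
pose L := (N + n).+1; pose r : R[i] := (2 * pi / f%:R)%:C.
have r0 : 0 < r by rewrite ltcR divr_gt0 ?mulr_gt0 ?pi_gt0 ?ltr0n.
pose num t := \sum_(1 <= a < f.+1) chi a%:Z * t ^+ N * expC (w a * t) / N`!%:R.
have Fjet : jet L (fun t => num t / bernoulli_denom N f t)
    (\poly_(k < L) (b k / k`!%:R)).
  apply: (jet_power_series _ _ _ r) => // t t0 tr.
  have := b_gen t t0 tr; rewrite /exp_gen_series /num mulr_suml.
  by under [X in series X]eq_fun do rewrite mulrCA mulrC.
have numjet : jet L num (\sum_(1 <= a < f.+1)
    'X^N * (\poly_(k < L) (w a ^+ k / k`!%:R)) * (chi a%:Z / N`!%:R)%:P).
  apply: jet_sum => a.
  have Xjet := jet_poly L ('X^N : {poly R[i]}); have Cjet := jet_poly L (chi a%:Z / N`!%:R)%:P.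
  apply: jet_near (jetM _ _ _ _ _ (jetM _ _ _ _ _ Xjet (jet_expC _ L (w a))) Cjet).
  by apply: nearW => t; rewrite hornerXn hornerC; ring.
have FD : \forall t \near (0 : R[i]^o)^',
    bernoulli_denom N f t * (num t / bernoulli_denom N f t) = num t.
  near=> t; rewrite mulrC divfK //; near: t; exact: bernoulli_denom_neq0.
have Nn : (N + n < L)%N by [].
pose D : {poly R[i]} :=
  \poly_(k < L) (f%:R ^+ k / k`!%:R) - \poly_(k < N) (f%:R ^+ k / k`!%:R).
pose P : {poly R[i]} := \poly_(k < L) (b k / k`!%:R).
have := jet_unique _ _ _ _ _ _ FD (jetM _ _ _ D P (jet_bernoulli_denom L) Fjet) numjet Nn.
rewrite coefM coef_sum -(big_mkord xpredT (fun j => D`_j * P`_(N + n - j))).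
(* The coefficients of [D] below N cancel; only the indices k + N with k <= n remain. *)
rewrite (big_cat_nat _ (n := N)) //= ?leqW ?leq_addr // big1_seq ?add0r; last first.
  move=> j /=; rewrite mem_index_iota => /= jN.
  by rewrite /D coefB !coef_poly jN ltnS (leq_trans (ltnW jN)) ?leq_addr // subrr mul0r.
rewrite -{1}[N]add0n big_addn subSn ?leq_addr // addKn big_mkord => conv.
(* The factor N! / f^N turns f^(k+N) / (k+N)! into alpha_k. *)
rewrite /moment; transitivity (N`!%:R / f%:R ^+ N *
  \sum_(k < n.+1) (f%:R ^+ (k + N) / (k + N)`!%:R * (b (n - k)%N / (n - k)`!%:R)) : R[i]).
  rewrite mulr_sumr; apply: eq_bigr => k _. rewrite exprD [(k + N)%N]addnC.
  by field; rewrite !fact_neq0 fX_neq0.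
transitivity (N`!%:R / f%:R ^+ N *
  \sum_(1 <= a < f.+1) (w a ^+ n / n`!%:R) * (chi a%:Z / N`!%:R) : R[i]).
  congr (_ * _); transitivity (\sum_(1 <= a < f.+1)
    ('X^N * (\poly_(k < L) (w a ^+ k / k`!%:R)) * (chi a%:Z / N`!%:R)%:P)`_(N + n)).
    rewrite -conv; apply: eq_bigr => k _; have kn : (k <= n)%N by rewrite -ltnS.
    have kNL : (k + N < L)%N by rewrite /L ltnS addnC leq_add2l.
    have NkN : (k + N < N)%N = false by rewrite ltnNge leq_addl.
    have nkL : (n - k < L)%N by rewrite /L ltnS (leq_trans (leq_subr _ _)) ?leq_addl.
    by rewrite /D /P coefB !coef_poly kNL NkN subr0 [(N + n)%N]addnC subnDr nkL.
  apply: eq_bigr => a _; rewrite coefMC coefXnM ltnNge leq_addr /= addKn coef_poly.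
  by rewrite ltnS leq_addl.
rewrite !mulr_sumr; apply: eq_bigr => a _.
by field; rewrite !fact_neq0 fX_neq0.
Unshelve. all: by end_near. Qed.

Lemma bernoulli_det (s : nat -> R[i]) :
  (forall m, s m = (f%:R ^+ N)^-1 * \sum_(1 <= a < f.+1)
     chi a%:Z * (N`!%:R / (N + m)`!%:R * f%:R ^+ m - w a ^+ m / m`!%:R)) ->
  forall n, (1 <= n)%N -> b n = (-1) ^+ n * n`!%:R * \det (bernoulli_mx N f n s).
Proof.
move=> sE [//|n] _; have b0 : b 0%N / 0`!%:R = moment 0%N.
  by have := bernoulli_convolution 0; rewrite big_ord1 mul1r.
have s_moment m : s m = alpha R N f (Posz m) * moment 0%N - moment m.
  rewrite sE alphaE /moment mulrCA -mulrBr; congr (_ * _).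
  rewrite mulr_sumr -sumrB; apply: eq_bigr => a _.
  by rewrite expr0 fact0 divr1 mulr1; ring.
have := @bernoulli_mx_solve R N f s (fun n => b n.+1 / n.+1`!%:R) _ n.
move=> /(_ _)/(canRL (divfK (fact_neq0 _))) ->; last first.
  (* The term k = m + 1 is alpha_(m+1) b_0 = alpha_(m+1) E_0; moved to the right, it leaves E_(m+1)
     - alpha_(m+1) E_0 = - [s m.+1]. *)
  move=> m; have := bernoulli_convolution m.+1; rewrite big_ord_recr /= subnn b0.
  rewrite s_moment opprB => /(canRL (addrK _)) <-.
  by apply: eq_bigr => k _; rewrite subSn // -ltnS.
by rewrite mulrAC.
Qed.

End GeneratingFunction.

Theorem theorem6p1 (R : realType) (N f : nat) (chi : int -> R[i])
    (B : nat -> R[i]) (Bx : nat -> R[i] -> R[i])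
    (hN : (1 <= N)%N)
    (hchi : dirichlet_character_of_conductor f chi)
    (hB : is_hypergeometric_bernoulli_numbers N f chi B)
    (hBx : is_hypergeometric_bernoulli_polynomials N f chi Bx)
    (n : nat) (hn : (1 <= n)%N) :
  B n = (-1) ^+ n * n`!%:R * \det (bernoulli_mx N f n (Shat N f chi)) /\
  forall x : R[i],
    Bx n x = (-1) ^+ n * n`!%:R
             * \det (bernoulli_mx N f n (fun m : nat => Shat_poly N f chi m x)).
Proof.
(* The conductor is an induced modulus, hence positive: f^N is invertible and the radius 2 pi / f is
   positive. *)
have [q [_ [f_gt0 _ _] _]] := hchi; split=> [|x].
  exact: (bernoulli_det _ _ _ _ _ f_gt0 hB).
exact: (bernoulli_det N f chi (fun a => x + a%:R) (Bx ^~ x) f_gt0 (hBx x)).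
Qed.
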